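(* Let $n\geq 2$ be an integer, let $K_{1,n}$ be the star with $n$ leaves, and let $\lambda_2$ be the second largest eigenvalue of the adjacency matrix of $\mathcal{R}(K_{1,n})$. Then 1. $h(\mathcal{R}(K_{1,n}))<\dfrac{2}{n-1}$, and 2. $\lambda_2>n-\dfrac{4}{n-1}$.
   Context: Graphs are finite, simple and undirected. A search tree $T$ on a connected graph $G$ is a rooted tree with vertex set $V(G)$, defined recursively: the root of $T$ is a chosen vertex $r\in V(G)$, and the children of $r$ are the roots of search trees on each of the connected components of $G-r$. Let $T$ be a search tree on $G$ and let $v$ be a child of $u$ in $T$. The $uv$-rotation transforms $T$ into the search tree $T'$ on $G$ such that: (i) $u$ is a child of $v$ in $T'$; if $u$ is the root of $T$ then $v$ is the root of $T'$, otherwise, if $p$ is the parent of $u$ in $T$, then $p$ is the parent of $v$ in $T'$; (ii) every subtree of $u$ in $T$ other than the one rooted at $v$ remains a subtree of $u$ in $T'$; (iii) each subtree $S$ of $v$ in $T$ becomes a subtree of $u$ in $T'$ if $u$ is adjacent in $G$ to some vertex of $S$, and otherwise remains a subtree of $v$. All other parent-child relations are unchanged. The rotation graph $\mathcal{R}(G)$ is the undirected graph whose vertices are the search trees on $G$, two search trees being adjacent if one is obtained from the other by a single rotation. It is $(|V(G)|-1)$-regular. The edge expansion of a graph $H$ is $h(H)=\min |\partial S|/|S|$ over nonempty $S\subseteq V(H)$ with $|S|\leq |V(H)|/2$, where $\partial S$ is the set of edges with one endpoint in $S$ and the other in $V(H)\setminus S$. Eigenvalues $\lambda_1\geq\lambda_2\geq\dots$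 are listed with multiplicity. *)

(* Defs.v *)
From mathcomp Require Import all_boot all_order all_algebra.
From mathcomp Require Import polyrcf.

Set Implicit Arguments.
Unset Strict Implicit.
Unset Printing Implicit Defensive.

Import Order.TTheory GRing.Theory Num.Theory.
Local Open Scope ring_scope.

Record sgraph := SGraph {
  vertex :> finType;
  adj : rel vertex;
  adj_sym : symmetric adj;
  adj_irr : irreflexive adj }.

Section SearchTrees.
Variable G : sgraph.

Definition induced (C : {set G}) : rel G :=
  [rel x y | [&& x \in C, y \in C & adj x y]].

Definition components (C : {set G}) : {set {set G}} :=
  equivalence_partition (connect (induced C)) C.

Definition connected : bool := [forall x, forall y, connect (@adj G) x y].

(* A rooted tree on the vertex set of G is given by its parent map, which sends
   the root to None. The name does not impose acyclicity: that is a consequence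
   of [is_search_tree] below. *)
Definition parent_map := {ffun G -> option G}.

(* [search_tree_rec k T C r]: the restriction of T to C is a search tree with
   root r on the subgraph induced by C. The number k only bounds the depth of
   the recursion; any k >= #|C| gives the same value. The value of [T r] is
   constrained only by the caller. *)
Fixpoint search_tree_rec (k : nat) (T : parent_map) (C : {set G}) (r : G)
    : bool :=
  if k is k'.+1 then
    (r \in C) &&
    [forall D in components (C :\ r),
       exists c in D, (T c == Some r) && search_tree_rec k' T D c]
  else false.

(* Meant for connected G. *)
Definition is_search_tree (T : parent_map) : bool :=
  [exists r, (T r == None) && search_tree_rec #|G| T [set: G] r].

Definition search_tree := {T : parent_map | is_search_tree T}.

Definition subtree (T : parent_map) (w : G) : {set G} :=
  [set x | connect [rel a b | T a == Some b] x w].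

(* The uv-rotation, meaningful when [T v = Some u]. *)
Definition rotate (T : parent_map) (u v : G) : parent_map :=
  [ffun x =>
     if x == v then T u
     else if x == u then Some v
     else if (T x == Some v) && [exists y in subtree T x, adj u y] then Some u
     else T x].

Definition rotates_to (T T' : search_tree) : bool :=
  [exists u, exists v,
     (val T v == Some u) && (val T' == rotate (val T) u v)].

Definition rotation_adj : rel search_tree :=
  [rel T T' | rotates_to T T' || rotates_to T' T].

Lemma search_tree_rec_parentN k (T : parent_map) (C : {set G}) (r x : G) :
  search_tree_rec k T C r -> x \in C -> x != r -> T x != Some x.
Proof.
elim: k C r => [//|k IHk] C r /= /andP[rC /forall_inP subT] xC xNr.
pose D := [set y in C :\ r | connect (induced (C :\ r)) x y].
have xCr : x \in C :\ r by rewrite !inE xNr.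
have D_comp : D \in components (C :\ r) by apply/imsetP; exists x.
have [c cD /andP[/eqP Tc Dc]] := exists_inP (subT D D_comp).
have [->|xNc] := eqVneq x c.
  rewrite Tc; apply: contraTneq cD => -[<-].
  by rewrite !inE eqxx.
by apply: IHk Dc _ xNc; rewrite inE xCr connect0.
Qed.

Lemma search_tree_parentN (T : search_tree) (x : G) : val T x != Some x.
Proof.
have /existsP[r /andP[/eqP Tr recT]] := valP T.
have [->|xNr] := eqVneq x r; first by rewrite Tr.
exact: search_tree_rec_parentN recT (in_setT x) xNr.
Qed.

Lemma rotates_to_irr : irreflexive rotates_to.
Proof.
move=> T; apply/negbTE/existsPn => u; apply/existsPn => v.
apply/negP => /andP[/eqP Tv /eqP eqT].
have := congr1 (fun f : parent_map => f v) eqT.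
rewrite /= ffunE eqxx Tv => /esym Tu.
by have := search_tree_parentN T u; rewrite Tu eqxx.
Qed.

Lemma rotation_adj_sym : symmetric rotation_adj.
Proof. by move=> T T'; rewrite /rotation_adj /= orbC. Qed.

Lemma rotation_adj_irr : irreflexive rotation_adj.
Proof. by move=> T; rewrite /rotation_adj /= rotates_to_irr. Qed.

Definition rotation_graph : sgraph :=
  SGraph rotation_adj_sym rotation_adj_irr.

End SearchTrees.

Section Star.
Variable n : nat.

(* The center of the star is None. *)
Definition star_adj : rel (option 'I_n) := [rel x y | isSome x != isSome y].

Lemma star_adj_sym : symmetric star_adj.
Proof. by move=> x y; rewrite /star_adj /= eq_sym. Qed.

Lemma star_adj_irr : irreflexive star_adj.
Proof. by move=> x; rewrite /star_adj /= eqxx. Qed.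

Definition star : sgraph := SGraph star_adj_sym star_adj_irr.

Lemma star_connected : connected star.
Proof.
have toC (x : star) : connect (@adj star) x None.
  by case: x => [i|]; [apply: connect1 | apply: connect0].
have fromC (y : star) : connect (@adj star) None y.
  by case: y => [i|]; [apply: connect1 | apply: connect0].
by apply/forallP => x; apply/forallP => y; apply: connect_trans (toC x) _.
Qed.

End Star.

Section EdgeExpansion.
Variables (R : rcfType) (H : sgraph).

Definition edge_boundary (S : {set H}) : {set {set H}} :=
  [set [set x; y] | x in S, y in ~: S & adj x y].

Definition expansion_ratio (S : {set H}) : R :=
  #|edge_boundary S|%:R / #|S|%:R.

Definition small_set : pred {set H} :=
  [pred S | (S != set0) && (#|S|.*2 <= #|H|)%N].

(* Minimum of a list of values, nonempty as soon as H has two vertices: the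
   initial value of the iteration is one of these values. *)
Definition edge_expansion : R :=
  let ratios := [seq expansion_ratio B | B : {set H} in small_set] in
  \big[Num.min/head 0 ratios]_(q <- ratios) q.

Lemma edge_expansion_le (S : {set H}) :
  small_set S -> edge_expansion <= expansion_ratio S.
Proof. by move=> Ssmall; apply: ge_bigmin_seq => //; apply: image_f. Qed.

Lemma edge_expansion_attained :
  (1 < #|H|)%N -> exists2 S, small_set S & edge_expansion = expansion_ratio S.
Proof.
move=> H_gt1.
have [x _] : exists x : H, x \in H by apply/card_gt0P; apply: ltnW.
have xsmall : [set x] \in small_set.
  by rewrite inE cards1 -cards_eq0 cards1.
suff /imageP[S Ssmall ->] :
    edge_expansion \in [seq expansion_ratio B | B : {set H} in small_set].
  by exists S.
rewrite /edge_expansion /=.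
have := image_f expansion_ratio xsmall.
set s := image _ _ => xs.
have head_s : head 0 s \in s by case: s xs => //= a s' _; rewrite mem_head.
rewrite big_seq; apply: (big_ind (fun q => q \in s)) => // a b aS bS.
by rewrite /Num.min; case: ifP.
Qed.

End EdgeExpansion.

Section Spectrum.
Variable R : rcfType.

(* The eigenvalues in R in nonincreasing order, each repeated according to its
   multiplicity as a root of the characteristic polynomial. For a symmetric
   matrix these are all the eigenvalues and the multiplicities are also the
   dimensions of the eigenspaces. *)
Definition eigenvalues m (A : 'M[R]_m) : seq R :=
  let p := char_poly A in
  sort >=%R (flatten [seq nseq (mup a p) a | a <- rootsR p]).

Definition adjacency_matrix (H : sgraph) : 'M[R]_#|H| :=
  \matrix_(i, j) (adj (enum_val i) (enum_val j))%:R.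

Definition lambda2 (H : sgraph) : R := (eigenvalues (adjacency_matrix H))`_1.

End Spectrum.

(* Main.v *)
Require Import Defs.
From mathcomp Require Import all_boot all_order all_algebra.
From mathcomp Require Import polyrcf complex ring lra zify.

(** A search tree on a star with center c is a path of distinct leaves that ends
    in c and carries the other leaves as children of c. It is therefore a
    duplicate-free sequence s of leaves, and each leaf a gives exactly one
    rotation: if a lies on the path it is exchanged with its successor there,
    which is the next entry of s or, for the last entry, c itself, and then a
    disappears from s; if a hangs below c it is exchanged with c and is appended to s.
    These moves are called flips below. In particular every search tree has at
    least n neighbours ([adj_flipP], [degree_rotation_star]).

    For the expansion, fix two leaves a and b and let S consist of the sequences
    in which a occurs and b does not occur before it: an absent leaf counts as
    standing after the end of the sequence, so this is the inequality
    index a s < index b s between indices. A flip leads out of S only if it is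
    the flip of a and index b s = index a s + 1: either b directly follows a, or
    a is last and b is absent ([flip_crossing]). Hence the boundary of S has at
    most as many edges as there are such sequences. With m = n - 2 other leaves, sorting
    by the first entry gives, for the numbers F of all sequences on m leaves, O of
    members of S and X of sequences with index b s = index a s + 1,
      F m = 1 + m F(m-1),   O m = F(m+1) + m O(m-1),   X m = F m + 1 + m X(m-1),
    and induction yields 2 O m <= F(m+2), so that S is small, and
    (m+1) X m < 2 O m, which is (n-1) |dS| < 2 |S| ([sparse_cut]).

    The bound on the second eigenvalue is the easy half of the discrete Cheeger
    inequality, lambda2 >= d - 2 |dS| / |S| for minimum degree d and |S| at most
    half of the vertices ([easy_cheeger]). On the plane of functions that are
    constant on S and on its complement, the quadratic form of the adjacency
    matrix is the sum of deg(x) f(x)^2 minus |dS| (a - b)^2, where a and b are the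
    two values; this exceeds t |f|^2 for every t below the bound, and by the
    Courant-Fischer principle ([eigenvalues_nth_gt]) two eigenvalues exceed t.
    The principle is derived over a real closed field R from the spectral theorem
    for Hermitian matrices over its algebraic closure R[i]. *)

Set Implicit Arguments.
Unset Strict Implicit.
Unset Printing Implicit Defensive.

Import Order.TTheory GRing.Theory Num.Theory.
Local Open Scope ring_scope.

(** * Eigenvalues of symmetric matrices over a real closed field *)

Section SymmetricEigenvalues.
Local Open Scope sesquilinear_scope.
Variable R : rcfType.

Local Notation C := (complex R).
Local Notation toC := (real_complex R).

Lemma conj_toC (x : R) : (toC x)^* = toC x.
Proof. by apply/CrealP/complex_realP; exists x. Qed.

Lemma ler_toC (x y : R) : (toC x <= toC y) = (x <= y).
Proof. by rewrite lecE /= eqxx. Qed.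

Lemma char_poly_diag_conj (F : fieldType) m (P : 'M[F]_m) (d : 'rV[F]_m) :
  P \in unitmx ->
  char_poly (invmx P *m diag_mx d *m P) = \prod_(i < m) ('X - (d 0 i)%:P).
Proof.
move=> Pu.
have -> : \prod_(i < m) ('X - (d 0 i)%:P) = char_poly (diag_mx d).
  rewrite char_poly_trig ?diag_mx_is_trig //.
  by apply: eq_bigr => i _; rewrite mxE eqxx mulr1n.
rewrite /char_poly /char_poly_mx; set D := diag_mx d.
have PX : map_mx polyC (invmx P) *m ('X%:M : 'M_m) *m map_mx polyC P = 'X%:M.
  by rewrite scalar_mxC -mulmxA -map_mxM mulVmx // map_mx1 mulmx1.
rewrite -[X in \det (X - _)]PX !map_mxM -mulmxBl -mulmxBr !det_mulmx mulrAC.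
by rewrite -det_mulmx -map_mxM mulVmx // map_mx1 det1 mul1r.
Qed.

(** Over R[i] a real symmetric matrix is Hermitian, so it is unitarily similar to
    a real diagonal matrix. The similarity P may have non-real entries, but the
    characteristic polynomial descends to R, where it therefore splits. *)
Lemma symmetric_diagonalization m (A : 'M[R]_m) : A^T = A ->
  exists (P : 'M[C]_m) (r : 'rV[R]_m),
    [/\ P \is unitarymx,
        map_mx toC A = P^t* *m diag_mx (map_mx toC r) *m P
      & char_poly A = \prod_(i < m) ('X - (r 0 i)%:P)].
Proof.
move=> Asym; set B := map_mx toC A.
have Breal : B \is a realmx.
  by apply/mxOverP => i j; rewrite mxE; apply/complex_realP; exists (A i j).
have Bherm : B \is hermsymmx.
  apply: realsym_hermsym => //; apply/is_hermitianmxP.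
  by rewrite expr0 scale1r map_mx_id // map_trmx Asym.
have dreal := hermitian_spectral_diag_real Bherm.
have /orthomx_spectralP eqB := hermitian_normalmx Bherm.
have Punit := spectral_unitarymx B.
set P := spectralmx B in eqB Punit.
set d := spectral_diag B in dreal eqB.
pose r := map_mx (@complex.Re R) d.
have dr : d = map_mx toC r.
  apply/rowP => i; rewrite !mxE; apply/esym/RRe_real.
  by move/mxOverP: dreal; apply.
exists P, r; split=> //.
  by rewrite -dr -invmx_unitary.
apply: (map_poly_inj toC); rewrite map_char_poly -/B eqB.
rewrite char_poly_diag_conj ?spectral_unit // rmorph_prod.
by apply: eq_bigr => i _; rewrite dr mxE /= map_polyXsubC.
Qed.

Lemma eigenvalues_sorted m (A : 'M[R]_m) : sorted >=%R (eigenvalues A).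
Proof. by apply: sort_sorted => x y; apply: le_total. Qed.

Lemma perm_eigenvalues m (A : 'M[R]_m) (s : seq R) :
  char_poly A = \prod_(a <- s) ('X - a%:P) -> perm_eq (eigenvalues A) s.
Proof.
move=> eqp; rewrite /eigenvalues; set p := char_poly A in eqp *.
have p_neq0 : p != 0 by rewrite monic_neq0 // char_poly_monic.
rewrite perm_sort /perm_eq; apply/allP => x _; apply/eqP.
rewrite count_flatten -map_comp -mu_prod_XsubC -eqp sumnE big_map.
under eq_bigr => a _ do rewrite /= count_nseq /=.
have [xr|xNr] := boolP (x \in rootsR p).
  rewrite (bigD1_seq x) ?uniq_roots //= eqxx mul1n big1 ?addn0 // => a aNx.
  by rewrite (negbTE aNx).
rewrite big1_seq; last first.
  by move=> a /= ar; case: eqVneq => // eqa; rewrite -eqa ar in xNr.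
by rewrite mupNroot //; move: xNr; rewrite -(roots_on_rootsR p_neq0).
Qed.

Lemma sorted_nth_gt (s : seq R) (t : R) k :
  sorted >=%R s -> (k < count (fun x => (t < x)%R) s)%N -> t < s`_k.
Proof.
elim: s k => [|x s IHs] k //= xs.
have s_le : all (fun y => y <= x) s by rewrite (order_path_min _ xs) //; apply: ge_trans.
case: k => [|k] /=.
  case: ltP => // x_le; rewrite add0n -has_count => /hasP[y ys ty].
  by have := lt_le_trans ty (allP s_le _ ys); rewrite ltNge x_le.
move=> kc; apply: IHs; first exact: path_sorted xs.
by move: kc; case: (t < x) => /=; [rewrite ltnS | rewrite add0n => /ltnW].
Qed.

(** A Hermitian form with real symmetric matrix is controlled by its values at
    real vectors: the mixed terms in x and y cancel. This transfers the
    positivity hypothesis of [eigenvalues_nth_gt] to the complex vectors that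
    the unitary diagonalization forces on its proof. *)
Lemma complex_quadratic_form k (G : 'M[R]_k) (x y : 'rV[R]_k) : G^T = G ->
  let c := map_mx toC x + 'i *: map_mx toC y in
  c *m map_mx toC G *m c^t* = map_mx toC (x *m G *m x^T + y *m G *m y^T).
Proof.
move=> Gsym c.
have -> : c^t* = map_mx toC x^T - 'i *: map_mx toC y^T.
  apply/matrixP => i j; rewrite !mxE rmorphD rmorphM /= conjCi !conj_toC.
  by rewrite mulNr.
have cross : x *m G *m y^T = y *m G *m x^T.
  rewrite -[LHS](_ : (x *m G *m y^T)^T = _); last first.
    by apply/matrixP => i j; rewrite !ord1 mxE.
  by rewrite !trmx_mul trmxK Gsym mulmxA.
rewrite /c !(mulmxDl, mulmxBr) -!scalemxAl -!scalemxAr.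
rewrite scalerA -expr2 sqrCi scaleN1r -!map_mxM cross map_mxD.
by rewrite opprB addrACA subrr addr0.
Qed.

Lemma quadratic_form_diag k m (W : 'M[C]_(k, m)) (d : 'rV[R]_m) (c : 'rV[C]_k) :
  (c *m (W *m diag_mx (map_mx toC d) *m W^t*) *m c^t*) 0 0 =
  \sum_i toC (d 0 i) * `|(c *m W) 0 i| ^+ 2.
Proof.
rewrite !mulmxA -mulmxA -(map_mxM Num.conj) -trmx_mul mxE.
by apply: eq_bigr => i _; rewrite mul_mx_diag !mxE normCK mulrAC [RHS]mulrC.
Qed.

(** One half of the Courant-Fischer principle; the rows of F span the test space.
    If at most k eigenvalues exceeded t, some nonzero combination of the k+1 rows
    would be orthogonal to all the corresponding eigenvectors, and the form
    A - t would be nonpositive there. *)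
Lemma eigenvalues_nth_gt m k (A : 'M[R]_m) (F : 'M[R]_(k.+1, m)) (t : R) :
  A^T = A ->
  (forall c : 'rV_k.+1, c != 0 ->
     0 < (c *m (F *m (A - t%:M) *m F^T) *m c^T) 0 0) ->
  t < (eigenvalues A)`_k.
Proof.
move=> Asym Fpos.
have [P [r [Punit eqA chA]]] := symmetric_diagonalization Asym.
apply: sorted_nth_gt (eigenvalues_sorted A) _.
have /permP -> : perm_eq (eigenvalues A) [seq r 0 i | i <- enum 'I_m].
  by apply: perm_eigenvalues; rewrite big_map big_enum.
(* W holds the coordinates of the rows of F in the eigenbasis. *)
pose W := map_mx toC F *m P^t*.
pose I := [set i : 'I_m | t < r 0 i].
have -> : count (fun x => t < x) [seq r 0 i | i <- enum 'I_m] = #|I|.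
  rewrite count_map enumT cardE /enum_mem size_filter.
  by apply: eq_count => i; rewrite /= inE.
rewrite ltnNge; apply/negP => I_le.
pose WI := colsub (fun i : 'I_#|I| => enum_val i) W.
have /rowV0Pn[c cker cN0] : kermx WI != 0.
  by rewrite kermx_eq0 /row_free neq_ltn (leq_ltn_trans (rank_leq_col _)).
have cWI i : t < r 0 i -> (c *m W) 0 i = 0.
  move=> ti; have iI : i \in I by rewrite inE.
  move/sub_kermxP/rowP/(_ (enum_rank_in iI i)): cker => eq0.
  rewrite mxE [RHS in _ = RHS]mxE in eq0; rewrite -eq0 mxE.
  by apply: eq_bigr => j _; rewrite [WI _ _]mxE enum_rankK_in.
pose G := F *m (A - t%:M) *m F^T.
have Gsym : G^T = G.
  by rewrite /G !trmx_mul trmxK raddfB /= Asym tr_scalar_mx mulmxA.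
have GW : map_mx toC G = W *m diag_mx (map_mx toC (r - const_mx t)) *m W^t*.
  have -> : W^t* = P *m map_mx toC F^T.
    rewrite /W trmx_mul map_mxM trmxCK; congr (_ *m _).
    by apply/matrixP => i j; rewrite !mxE; exact: conj_toC.
  rewrite /G /W !map_mxM -!mulmxA; congr (_ *m _); rewrite !mulmxA.
  congr (_ *m _); rewrite [LHS]map_mxB /= map_scalar_mx eqA.
  rewrite [map_mx _ (r - _)]map_mxB linearB /= mulmxBr mulmxBl; congr (_ - _).
  rewrite map_const_mx diag_const_mx scalar_mxC -mulmxA.
  by rewrite -(invmx_unitary Punit) mulVmx ?unitarymx_unit // mulmx1.
pose x := map_mx (@complex.Re R) c; pose y := map_mx (@complex.Im R) c.
have cxy : c = map_mx toC x + 'i *: map_mx toC y.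
  by apply/rowP => i; rewrite !mxE [LHS]complexE.
have := quadratic_form_diag W (r - const_mx t) c.
rewrite -GW cxy complex_quadratic_form // -cxy mxE mxE => eqsum.
have G_ge0 (z : 'rV_k.+1) : 0 <= (z *m G *m z^T) 0 0.
  have [->|z0] := eqVneq z 0; first by rewrite !mul0mx mxE.
  exact/ltW/Fpos.
have : toC ((x *m G *m x^T) 0 0 + (y *m G *m y^T) 0 0) <= 0.
  rewrite eqsum sumr_le0 // => i _; have [ti|it] := ltP t (r 0 i).
    by rewrite cWI // normr0 expr0n mulr0.
  by rewrite mulr_le0_ge0 ?exprn_ge0 // -(rmorph0 toC) ler_toC !mxE subr_le0.
rewrite -(rmorph0 toC) ler_toC leNgt; case/negP.
have [x0|xN0] := eqVneq x 0; last by rewrite ltr_pwDl // Fpos.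
rewrite ltr_wpDl // Fpos //; apply: contra_neq cN0 => y0.
by rewrite cxy x0 y0 !map_mx0 scaler0 addr0.
Qed.

End SymmetricEigenvalues.

(** * The easy half of the discrete Cheeger inequality *)

Section EasyCheeger.
Variables (R : rcfType) (H : sgraph).

Definition cut_pairs (S : {set H}) : {set H * H} :=
  [set z | [&& z.1 \in S, z.2 \notin S & adj z.1 z.2]].

(** The endpoint in S orients a boundary edge, so unordered edges and ordered
    pairs are equally many. *)
Lemma card_edge_boundary (S : {set H}) : #|edge_boundary S| = #|cut_pairs S|.
Proof.
have -> : edge_boundary S = [set [set z.1; z.2] | z in cut_pairs S].
  apply/setP => e; apply/imset2P/imsetP.
    case=> x y xS; rewrite !inE => /andP[yS xy] ->.
    by exists (x, y); rewrite // inE /= xS yS.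
  case=> -[x y]; rewrite inE /= => /and3P[xS yS xy] ->.
  by exists x y; rewrite // !inE yS.
apply: card_in_imset => -[x y] [x' y']; rewrite !inE /=.
move=> /and3P[xS yS _] /and3P[x'S y'S _] /setP eqe.
have := eqe x; have := eqe y; rewrite !inE !eqxx orbT /=.
have [eqyx'|yNx'] := eqVneq y x'; first by rewrite eqyx' x'S in yS.
rewrite /= => /esym/eqP ->; have [->//|xNx' /=] := eqVneq x x'.
by move=> /esym/eqP eqxy'; rewrite -eqxy' xS in y'S.
Qed.

Lemma sum_cut_pairs (S : {set H}) :
  \sum_(x in S) \sum_(y | y \notin S) ((adj x y)%:R : R)
    = #|edge_boundary S|%:R.
Proof.
rewrite card_edge_boundary -sum1_card natr_sum.
rewrite pair_big_dep /= [LHS]big_mkcond [RHS]big_mkcond /=.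
apply: eq_bigr => -[x y] _ /=; rewrite inE /=.
by case: (x \in S) (y \in S) (adj x y) => [] [] [].
Qed.

Definition degree (x : H) : nat := #|[set y | adj x y]|.

Lemma sum_adj_degree (x : H) : \sum_y ((adj x y)%:R : R) = (degree x)%:R.
Proof.
rewrite /degree -sum1_card natr_sum [RHS]big_mkcond /=.
by apply: eq_bigr => y _; rewrite inE; case: adj.
Qed.

Lemma sum_cut_pairsC (S : {set H}) :
  \sum_(x | x \notin S) \sum_(y in S) ((adj x y)%:R : R)
    = #|edge_boundary S|%:R.
Proof.
rewrite -sum_cut_pairs exchange_big /=.
by apply: eq_bigr => x _; apply: eq_bigr => y _; rewrite adj_sym.
Qed.

(** Writing f x * f y as f x ^+ 2 - f x * (f x - f y), only boundary edges
    contribute to the last term: a * (a - b) from their end in S and b * (b - a)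
    from the other end, which add up to (a - b) ^+ 2. *)
Lemma quadratic_form_cut (S : {set H}) (a b : R) :
  let f x := if x \in S then a else b in
  \sum_x \sum_y f x * (adj x y)%:R * f y =
    \sum_x (degree x)%:R * f x ^+ 2 - #|edge_boundary S|%:R * (a - b) ^+ 2.
Proof.
move=> f.
have inner x : \sum_y f x * (adj x y)%:R * f y =
    (degree x)%:R * f x ^+ 2 - \sum_y (adj x y)%:R * (f x * (f x - f y)).
  rewrite -sum_adj_degree mulr_suml -sumrB; apply: eq_bigr => y _; ring.
under eq_bigr => x _ do rewrite inner.
rewrite sumrB; congr (_ - _).
rewrite (bigID (mem S)) /=.
rewrite (_ : _ * _ = #|edge_boundary S|%:R * (a * (a - b))
           + #|edge_boundary S|%:R * (b * (b - a))); last by ring.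
congr (_ + _).
  rewrite -sum_cut_pairs mulr_suml; apply: eq_bigr => x xS.
  rewrite mulr_suml (bigID (mem S)) /= big1 ?add0r => [|y yS].
    by apply: eq_bigr => y yS; rewrite /f xS (negbTE yS).
  by rewrite /f xS yS subrr !mulr0.
rewrite -sum_cut_pairsC mulr_suml; apply: eq_bigr => x xS.
rewrite mulr_suml (bigID (mem S)) /= [X in _ + X]big1 ?addr0 => [|y yS].
  by apply: eq_bigr => y yS; rewrite /f yS (negbTE xS).
by rewrite /f (negbTE xS) (negbTE yS) subrr !mulr0.
Qed.

Lemma sum_enum_val (F : H -> R) : \sum_(i < #|H|) F (enum_val i) = \sum_x F x.
Proof.
rewrite [RHS](reindex (@enum_val H H)) //=.
exact: (onW_bij _ (@enum_val_bij H)).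
Qed.

Lemma sum_sq_cut (S : {set H}) (a b : R) :
  \sum_x (if x \in S then a else b) ^+ 2 =
    #|S|%:R * a ^+ 2 + #|~: S|%:R * b ^+ 2.
Proof.
rewrite (bigID (mem S)) /=; congr (_ + _).
  by under eq_bigr => x xS do rewrite xS; rewrite sumr_const mulr_natl.
rewrite (eq_bigl (mem (~: S))); last by move=> x; rewrite /= in_setC.
rewrite (eq_bigr (fun=> b ^+ 2)); last by move=> x; rewrite /= in_setC => /negbTE ->.
by rewrite sumr_const mulr_natl.
Qed.

(** The test plane is spanned by the indicator functions of S and of its
    complement. With e boundary edges, e * (a - b) ^+ 2 is at most
    2 * e * (a ^+ 2 + b ^+ 2), while the squared norm of f is at least
    #|S| * (a ^+ 2 + b ^+ 2) because S is the smaller side. *)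
Theorem easy_cheeger (d : nat) (S : {set H}) (t : R) :
  (forall x, (d <= degree x)%N) -> small_set S ->
  t < d%:R - 2 * expansion_ratio R S -> t < lambda2 R H.
Proof.
move=> deg_ge /andP[S0 S_half] t_lt.
pose F : 'M[R]_(2, #|H|) :=
  \matrix_(i, j) ((enum_val j \in S) (+) (i != 0))%:R.
apply: (eigenvalues_nth_gt (F := F)).
  by apply/matrixP => i j; rewrite !mxE adj_sym.
move=> c cN0; set a := c 0 0; set b := c 0 1.
have ab : 0 < a ^+ 2 + b ^+ 2.
  have [a0|aN0] := eqVneq a 0; last first.
    by rewrite ltr_pwDl ?sqr_ge0 // exprn_even_gt0.
  rewrite a0 expr0n add0r exprn_even_gt0 //=.
  apply: contra_neq cN0 => b0; apply/rowP => i; rewrite mxE.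
  case: (unliftP 0 i) => [j|] ->; rewrite ?ord1 //.
  by rewrite [lift _ _](_ : _ = 1) //; apply: val_inj.
pose f x := if x \in S then a else b.
have cF : c *m F = \row_j f (enum_val j).
  apply/rowP => j; rewrite !mxE big_ord_recl big_ord1 !mxE /f /=.
  rewrite (_ : lift _ _ = 1) ?eqxx; last exact: val_inj.
  by case: (_ \in S); rewrite /= ?mulr1 ?mulr0 ?addr0 ?add0r.
rewrite !mulmxA -mulmxA -trmx_mul cF.
set v := \row_j _.
have -> : (v *m (adjacency_matrix R H - t%:M) *m v^T) 0 0 =
    \sum_x \sum_y f x * (adj x y)%:R * f y - t * \sum_x f x ^+ 2.
  rewrite mulmxBr mulmxBl mul_mx_scalar -scalemxAl [LHS]mxE; congr (_ + _).
    rewrite mxE [RHS]exchange_big /= -sum_enum_val; apply: eq_bigr => j _.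
    rewrite mxE mulr_suml -[RHS]sum_enum_val; apply: eq_bigr => i _.
    by rewrite !mxE.
  rewrite !mxE -sum_enum_val; congr (- (t * _)).
  by apply: eq_bigr => i _; rewrite !mxE expr2.
rewrite quadratic_form_cut sum_sq_cut.
set e : R := #|edge_boundary S|%:R; set p : R := #|S|%:R.
have p_gt0 : 0 < p by rewrite ltr0n card_gt0.
have e_ge0 : 0 <= e by rewrite ler0n.
have p_le : p <= #|~: S|%:R by rewrite ler_nat; have := cardsC S; lia.
have gap : 2 * e < (d%:R - t) * p.
  by rewrite -ltr_pdivrMr // -mulrA ltrBrDl -ltrBrDr.
have d_le : d%:R * (p * a ^+ 2 + #|~: S|%:R * b ^+ 2)
    <= \sum_x (degree x)%:R * f x ^+ 2.
  rewrite -sum_sq_cut mulr_sumr; apply: ler_sum => x _.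
  by rewrite ler_wpM2r ?sqr_ge0 // ler_nat.
have a2 := sqr_ge0 a; have b2 := sqr_ge0 b.
have dt : 0 < d%:R - t by rewrite -(pmulr_lgt0 _ p_gt0) (le_lt_trans _ gap) // mulr_ge0.
have h1 : (d%:R - t) * (p * b ^+ 2) <= (d%:R - t) * (#|~: S|%:R * b ^+ 2).
  by rewrite ler_pM2l // ler_wpM2r.
have h2 : 2 * e * (a ^+ 2 + b ^+ 2) < (d%:R - t) * p * (a ^+ 2 + b ^+ 2).
  by rewrite ltr_pM2r.
(* (a - b) ^+ 2 = 2 * (a ^+ 2 + b ^+ 2) - (a + b) ^+ 2 *)
have h3 : 0 <= e * (a + b) ^+ 2 by rewrite mulr_ge0 ?sqr_ge0.
rewrite -/f; move: d_le h1 h2 h3; set s := \sum_x _; set q : R := #|~: S|%:R.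
move=> d_le h1 h2 h3; lra.
Qed.

End EasyCheeger.

(** * Flips of duplicate-free sequences *)

Section Flips.
Local Open Scope nat_scope.
Variable T : eqType.
Implicit Types (s t l r : seq T) (a b c : T).

Lemma uniq_mid_notin l a r : uniq (l ++ a :: r) -> a \notin l.
Proof. by rewrite cat_uniq => /and3P[_ /norP[]]. Qed.

(** The rotation that belongs to the leaf a, on the sequence s of leaves above
    the center. The three branches exchange a with the center from below it, with
    the center from above it, and with the next leaf. *)
Definition flip a s :=
  let l := take (index a s) s in
  match drop (index a s) s with
  | [::] => rcons l a
  | [:: _] => l
  | _ :: b :: r => l ++ [:: b, a & r]
  end.

Lemma flip_swap l a b r : a \notin l ->
  flip a (l ++ [:: a, b & r]) = l ++ [:: b, a & r].
Proof.
move=> aNl; rewrite /flip index_cat (negbTE aNl) /= eqxx addn0.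
by rewrite take_size_cat // drop_size_cat.
Qed.

Lemma flip_last l a : a \notin l -> flip a (rcons l a) = l.
Proof.
move=> aNl; rewrite /flip -cats1 index_cat (negbTE aNl) /= eqxx addn0.
by rewrite take_size_cat // drop_size_cat.
Qed.

Lemma flip_notin s a : a \notin s -> flip a s = rcons s a.
Proof.
move=> aNs; rewrite /flip (memNindex aNs).
by rewrite drop_size take_size.
Qed.

Variant flip_spec a : seq T -> seq T -> Prop :=
| FlipSwap l b r of uniq (l ++ [:: a, b & r]) & a \notin l :
    flip_spec a (l ++ [:: a, b & r]) (l ++ [:: b, a & r])
| FlipDrop l of uniq (rcons l a) & a \notin l : flip_spec a (rcons l a) l
| FlipAdd s of uniq s & a \notin s : flip_spec a s (rcons s a).

Lemma flipP a s : uniq s -> flip_spec a s (flip a s).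
Proof.
move=> s_uniq; have [as_|aNs] := boolP (a \in s); last first.
  by rewrite flip_notin //; constructor.
case/splitPr: as_ s_uniq => l [|b r] s_uniq; have aNl := uniq_mid_notin s_uniq.
  by rewrite cats1 in s_uniq *; rewrite flip_last //; constructor.
by rewrite flip_swap //; constructor.
Qed.

Lemma flip_uniq a s : uniq s -> uniq (flip a s).
Proof.
case/(flipP a) => [l b r s_uniq _|l|{}s s_uniq aNs].
- rewrite (perm_uniq (_ : perm_eq _ (l ++ [:: a, b & r]))) //.
  by rewrite perm_cat2l; apply/permPl/(perm_catCA [:: b] [:: a] r).
- by rewrite rcons_uniq => /andP[].
by rewrite rcons_uniq aNs.
Qed.

Lemma flip_inverse a s : uniq s -> exists b, flip b (flip a s) = s.
Proof.
case/(flipP a) => [l b r s_uniq aNl|l _ aNl|{}s _ aNs].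
- exists b; rewrite flip_swap //.
  rewrite -cat_rcons in s_uniq; have := uniq_mid_notin s_uniq.
  by rewrite mem_rcons inE negb_or => /andP[].
- by exists a; rewrite flip_notin.
by exists a; rewrite flip_last.
Qed.

Lemma take_flip a s i : i <= index a s -> take i (flip a s) = take i s.
Proof.
move=> i_le; have i_le_s := leq_trans i_le (index_size a s).
set j := index a s in i_le.
have -> : take i s = take i (take j s) by rewrite take_takel.
have size_j : size (take j s) = j by rewrite size_take_min; apply/minn_idPl/index_size.
rewrite /flip -/j; case: (drop j s) => [|_ [|b r]] //.
  by rewrite -cats1 takel_cat ?size_j.
by rewrite takel_cat ?size_j.
Qed.

(** Suppose a stands before b. The flip at b does not touch the entries up to and
    including a, whereas the flip at a removes a from that prefix. *)
Lemma flip_inj s : uniq s -> injective (fun a => flip a s).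
Proof.
move=> s_uniq.
have main a b : index a s < index b s -> flip a s <> flip b s.
  move=> ab eqm; have := take_flip ab; rewrite -eqm.
  case: (flipP a s_uniq) ab {eqm} => [l c r l_uniq aNl|l _ aNl|s' _ aNs].
  - rewrite index_cat (negbTE aNl) /= eqxx addn0 => _.
    rewrite !take_cat ltnNge leqnSn /= subSnn /= => /eqP.
    rewrite eqseq_cat // eqxx /= ?take0 eqseq_cons => /andP[/eqP eqca _].
    by move: l_uniq; rewrite cat_uniq eqca /= inE eqxx !andbF.
  - rewrite -cats1 index_cat (negbTE aNl) /= eqxx addn0 => _.
    rewrite take_oversize // take_oversize ?size_cat ?addn1 // => /(congr1 size).
    by rewrite size_cat addn1 => /n_Sn.
  by rewrite memNindex // ltnNge index_size.
move=> a b /= eqm; case: (ltngtP (index a s) (index b s)) => [/main//|/main/nesym//|eqi].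
have [as_|aNs] := boolP (a \in s).
  by rewrite -(nth_index a as_) eqi nth_index // -index_mem -eqi index_mem.
have bNs : b \notin s by rewrite -index_mem -eqi index_mem.
by move: eqm; rewrite !flip_notin // => /rcons_inj[].
Qed.

(** As [index] is the size of s for an absent element, an absent b counts as
    following every entry, and an absent a precedes nothing. *)
Definition precedes a b s := index a s < index b s.

(** For a to stop preceding b, the two must be exchanged with each other, or a,
    being last, must be dropped while b is absent. Both are the flip of a, and b
    has the index after that of a. *)
Lemma flip_crossing a b c s : uniq s -> a != b ->
  precedes a b s -> ~~ precedes a b (flip c s) ->
  c = a /\ index b s = (index a s).+1.
Proof.
rewrite /precedes.
case/(flipP c) => [l d r s_uniq cNl|l _ cNl|{}s _ cNs] aNb.
- have cNd : c != d.
    rewrite -cat_rcons in s_uniq; have := uniq_mid_notin s_uniq.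
    by rewrite mem_rcons inE negb_or eq_sym => /andP[].
  rewrite !index_cat /=.
  have [al|aNl] := boolP (a \in l); have [bl|bNl] := boolP (b \in l).
  + by move=> ->.
  + by move: al; rewrite -index_mem => al _; rewrite ltn_addr.
  + move: bl; rewrite -index_mem => bl.
    by rewrite ltnNge (leq_trans (ltnW bl)) ?leq_addr.
  have [eqca|cNa] := eqVneq c a; have [eqcb|cNb] := eqVneq c b;
    have [eqda|dNa] := eqVneq d a; have [eqdb|dNb] := eqVneq d b; subst;
    rewrite ?eqxx // in aNb cNd *; try by [lia | rewrite addn0 addn1].
- rewrite -cats1 !index_cat /=.
  have [al|aNl] := boolP (a \in l); have [bl|bNl] := boolP (b \in l).
  + by move=> ->.
  + by move: al; rewrite -index_mem (memNindex bNl) => ->.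
  + move: bl; rewrite -index_mem => bl.
    by rewrite ltnNge (leq_trans (ltnW bl)) ?leq_addr.
  case: (eqVneq c a) => [<-|_]; case: (eqVneq c b) => [eqcb|_]; try lia.
  by move=> _ _; split=> //; lia.
rewrite -cats1 !index_cat /=.
have [as_|aNs] := boolP (a \in s); have [bs|bNs] := boolP (b \in s).
- by move=> ->.
- by move: as_; rewrite -index_mem => as_ _; rewrite ltn_addr.
- by move: bs; rewrite -index_mem (memNindex aNs) => /ltnW; rewrite leqNgt => /negbTE->.
by rewrite !memNindex // ltnn.
Qed.

End Flips.

(** * Search trees on a star and their rotations *)

Section StarTrees.
Local Open Scope nat_scope.
Variable n : nat.
Implicit Types (s t : seq 'I_n) (a b : 'I_n) (x y : star n)
  (p : option (star n)) (C : {set star n}).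

Local Notation leaf := (Some : 'I_n -> star n).
Local Notation center := (None : star n).

Definition path_top s : star n := if s is a :: _ then leaf a else center.

(** The parent map of the search tree whose topmost vertices are the entries of s,
    in this order, followed by the center. The parent p of its root is a
    parameter so that subtrees have the same shape. *)
Fixpoint path_parent p s x : option (star n) :=
  if s is a :: s' then
    if x == leaf a then p else path_parent (Some (leaf a)) s' x
  else if x == center then p else Some center.

Lemma path_parent_top p s : path_parent p s (path_top s) = p.
Proof. by case: s => [|a s] /=; rewrite ?eqxx. Qed.

(** Components of a set of vertices of the star: everything hangs together
    through the center, and without it all vertices are isolated. *)
Lemma components_center C : center \in C -> components C = [set C].
Proof.
move=> cC.
have conn x y : x \in C -> y \in C -> connect (induced C) x y.
  have toC z : z \in C -> connect (induced C) z center.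
    case: z => [a|] zC; last exact: connect0.
    by apply: connect1; rewrite /induced /= zC cC.
  have fromC z : z \in C -> connect (induced C) center z.
    case: z => [a|] zC; last exact: connect0.
    by apply: connect1; rewrite /induced /= zC cC.
  by move=> xC yC; apply: connect_trans (toC x xC) (fromC y yC).
have class x : x \in C -> [set y in C | connect (induced C) x y] = C.
  move=> xC; apply/setP => y; rewrite inE.
  by case: (boolP (y \in C)) => //= yC; rewrite conn.
apply/setP => D; rewrite inE; apply/imsetP/eqP => [[x xC ->]|->].
  exact: class.
by exists center; rewrite // class.
Qed.

Lemma components_leaves C : center \notin C ->
  components C = [set [set x] | x in C].
Proof.
move=> cC; apply: eq_in_imset => x xC; apply/setP => y; rewrite !inE.
apply/andP/eqP => [[_ /connectP[[|z q] /= path_q ->]]|->] //.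
  move: path_q; rewrite /induced /star_adj /= => /andP[/and3P[_ zC]].
  case: x z xC zC => [a|] [b|] // xC zC; first by rewrite (negbTE cC) in zC.
  by rewrite (negbTE cC) in xC.
Qed.

(** While the roots are leaves, removing one leaves a single component, which has
    a single root: the tree is a path. Once the center is removed, all remaining
    leaves are separate components, hence children of the center. *)
Lemma search_tree_rec_path k (T : parent_map (star n)) C r :
  center \in C -> search_tree_rec k T C r ->
  exists s, [/\ uniq s, {in s, forall a, leaf a \in C}, r = path_top s
    & {in C, forall x, T x = path_parent (T r) s x}].
Proof.
elim: k C r => [|k IHk] C r //= cC /andP[rC /forall_inP sub].
case: r rC sub => [a|] rC sub; last first.
  exists [::]; split=> // x xC /=; have [->//|xNc] := eqVneq x center.
  have xD : [set x] \in components (C :\ center).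
    by rewrite components_leaves ?setD11 // imset_f // !inE xNc.
  by have /exists_inP[y /set1P -> /andP[/eqP->]] := sub _ xD.
have cC' : center \in C :\ leaf a by rewrite !inE.
have CD : C :\ leaf a \in components (C :\ leaf a).
  by rewrite components_center ?inE.
have /exists_inP[c cD /andP[/eqP Tc Dc]] := sub _ CD.
have [s [s_uniq sC c_top Ts]] := IHk _ _ cC' Dc.
exists (a :: s); split=> //=.
- rewrite s_uniq andbT; apply/negP => aS.
  by have := sC a aS; rewrite setD11.
- move=> b; rewrite inE => /predU1P[->//|/sC].
  by rewrite inE => /andP[].
- move=> x xC; have [->//|xNa] := eqVneq x (leaf a).
  by rewrite Ts ?Tc // !inE xNa.
Qed.

Lemma path_search_tree_rec k (T : parent_map (star n)) C p s :
  center \in C -> uniq s -> {in s, forall a, leaf a \in C} -> #|C| <= k ->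
  {in C, forall x, T x = path_parent p s x} ->
  search_tree_rec k T C (path_top s).
Proof.
elim: k C p s => [|k IHk] C p s cC s_uniq sC.
  by rewrite leqn0 cards_eq0 => /eqP C0; rewrite C0 inE in cC.
move=> C_le Ts; apply/andP; split.
  by case: s sC {s_uniq Ts} => [|a s] //= ->; rewrite ?mem_head.
apply/forall_inP => D; case: s s_uniq sC Ts => [|a s] /= s_uniq sC Ts.
  rewrite components_leaves ?setD11 // => /imsetP[x].
  rewrite !inE => /andP[xNc xC] ->; apply/exists_inP; exists x; rewrite ?inE //.
  rewrite Ts // (negbTE xNc) eqxx /=.
  case: k {IHk} C_le => [|k] C_le.
    have := subset_leq_card (_ : [set x; center] \subset C).
    rewrite cards2 xNc => /(_ _)/leq_trans/(_ C_le); apply.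
    by apply/subsetP => y; rewrite !inE => /orP[] /eqP ->.
  rewrite /= inE eqxx; apply/forall_inP => E.
  by rewrite /components setDv => /imsetP[y]; rewrite inE.
have cC' : center \in C :\ leaf a by rewrite !inE.
case/andP: s_uniq => aNs s_uniq.
have sC' : {in s, forall b, leaf b \in C :\ leaf a}.
  move=> b bs; rewrite !inE sC ?inE ?bs ?orbT // andbT.
  by apply: contraNneq aNs => -[<-].
rewrite components_center // inE => /eqP ->.
have topC : path_top s \in C :\ leaf a.
  by case: s sC' {aNs s_uniq sC Ts} => [|b s] //= ->; rewrite ?mem_head.
have Ts' : {in C :\ leaf a, forall x, T x = path_parent (Some (leaf a)) s x}.
  by move=> x; rewrite !inE => /andP[/negbTE xNa xC]; rewrite Ts // xNa.
apply/exists_inP; exists (path_top s) => //.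
rewrite Ts' // path_parent_top eqxx /=; apply: IHk Ts' => //.
by move: C_le; rewrite (cardsD1 (leaf a)) sC ?mem_head.
Qed.

Definition path_tree s : parent_map (star n) :=
  [ffun x => path_parent None s x].

Lemma path_treeP (T : parent_map (star n)) :
  reflect (exists2 s, uniq s & T = path_tree s) (is_search_tree T).
Proof.
apply: (iffP existsP) => [[r /andP[/eqP Tr recT]]|[s s_uniq ->]].
  have [s [s_uniq _ _ Ts]] := search_tree_rec_path (in_setT _) recT.
  exists s => //; apply/ffunP => x.
  by rewrite ffunE Ts ?inE // Tr.
exists (path_top s); rewrite ffunE path_parent_top eqxx /=.
apply: (path_search_tree_rec (p := None)); rewrite ?inE ?cardsT //.
by move=> x _; rewrite ffunE.
Qed.

Lemma path_parent_notin p s a :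
  a \notin s -> path_parent p s (leaf a) = Some center.
Proof.
elim: s p => [|b s IHs] p //=; rewrite inE negb_or => /andP[aNb aNs].
by rewrite ifN ?IHs //; apply: contra_neq aNb => -[].
Qed.

Lemma path_parent_range p s x c :
  path_parent p s x = Some (leaf c) -> p = Some (leaf c) \/ c \in s.
Proof.
elim: s p => [|b s IHs] p /=; first by case: eqP => // _ ->; left.
case: eqP => [_ ->|_ /IHs[[->]|cs]]; first by left.
  by right; rewrite mem_head.
by right; rewrite inE cs orbT.
Qed.

Lemma path_parent_notop p q s x :
  x != path_top s -> path_parent p s x = path_parent q s x.
Proof. by case: s => [|a s] /= /negbTE ->. Qed.

Lemma path_parent_cat p s t x :
  path_parent p (s ++ t) x =
    if x \in map leaf s then path_parent p s x
    else path_parent (last p [seq Some (leaf a) | a <- s]) t x.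
Proof.
elim: s p => [|a s IHs] p //=; rewrite inE.
by case: eqP => //= _; apply: IHs.
Qed.

Lemma mem_map_leaf a s : (leaf a \in map leaf s) = (a \in s).
Proof. by rewrite mem_map // => ? ? []. Qed.

Lemma mem_map_center s : center \in map leaf s = false.
Proof. by apply/mapP => -[]. Qed.

Lemma path_parent_None p s x : path_parent p s x = None -> p = None.
Proof.
by elim: s p => [|b s IHs] p /=; case: eqP => // _ /IHs.
Qed.

Lemma path_parent_center p s a :
  path_parent p s (leaf a) = Some center -> p = Some center \/ a \notin s.
Proof.
elim: s p => [|b s IHs] p /=; first by right.
case: eqP => [_ ->|aNb /IHs[//|aNs]]; [by left | right].
by rewrite inE negb_or aNs andbT; apply: contra_not_neq aNb => ->.
Qed.

(** The hypotheses on p say that p is not a value that the map takes within the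
    path or below it, so that only the top vertex can have p as its parent. *)
Lemma path_parent_eq_top p s x :
  p <> Some center -> (forall a, p = Some (leaf a) -> a \notin s) ->
  path_parent p s x = p -> x = path_top s.
Proof.
move=> pNc pNs; apply: contra_eq; case: s pNs => [|a s] pNs /= /negbTE -> //.
  by apply/eqP => /esym.
apply/eqP; case: p pNc pNs => [[c|]|] // _ pNs; last by move/path_parent_None.
have := pNs c (erefl _); rewrite inE negb_or => /andP[cNa cNs].
by case/path_parent_range => [[eqac]|cs]; [rewrite eqac eqxx in cNa | rewrite cs in cNs].
Qed.

(** The first entry of s is recovered as the vertex with parent p, and then
    serves as p for the rest of s. *)
Lemma path_parent_inj p s t :
  p <> Some center -> (forall a, p = Some (leaf a) -> a \notin s ++ t) ->
  uniq s -> uniq t -> path_parent p s =1 path_parent p t -> s = t.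
Proof.
elim: s p t => [|a s IHs] p t pNc pN s_uniq t_uniq eqp.
  have : path_top [::] = path_top t.
    apply: (path_parent_eq_top (p := p)) => //.
    by rewrite -eqp path_parent_top.
  by case: t {pN t_uniq eqp}.
have : path_top (a :: s) = path_top t.
  apply: (path_parent_eq_top (p := p)) => //; last by rewrite -eqp path_parent_top.
  by move=> b /pN; rewrite mem_cat negb_or => /andP[].
case: t pN t_uniq eqp => [|b t] //= pN /andP[bNt t_uniq] eqp [eqab].
case/andP: s_uniq => aNs s_uniq; rewrite -eqab in bNt eqp *; congr (_ :: _).
apply: (IHs (Some (leaf a))) => // [c [<-]|x].
  by rewrite mem_cat negb_or aNs.
have [->|xNa] := eqVneq x (leaf a); first by rewrite !path_parent_notin.
by have := eqp x; rewrite (negbTE xNa).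
Qed.

Lemma path_tree_inj : {in [pred s | uniq s] &, injective path_tree}.
Proof.
move=> s t; rewrite !inE => s_uniq t_uniq /ffunP eqT.
apply: (path_parent_inj (p := None)) => // x.
by have := eqT x; rewrite !ffunE.
Qed.

Variant path_child s : star n -> star n -> Prop :=
| ChildLeaf l a b r of s = l ++ [:: a, b & r] : path_child s (leaf a) (leaf b)
| ChildCenter l a of s = rcons l a : path_child s (leaf a) center
| ChildPendant a of a \notin s : path_child s center (leaf a).

Lemma path_tree_child s u v : path_tree s v = Some u -> path_child s u v.
Proof.
rewrite ffunE.
suff main p : path_parent p s v = Some u ->
    p = Some u /\ v = path_top s \/ path_child s u v.
  by case/main => [[]|].
elim: s p => [|c s IHs] p /=.
  case: eqP => [-> ->|vNc [<-]]; [by left | right].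
  by case: v vNc => [a|] // _; constructor.
case: eqP => [-> ->|vNc /IHs[[[<-] ->]|child]]; [by left | right | right].
  case: s {IHs} => [|b s]; first exact: (@ChildCenter _ [::]).
  exact: (@ChildLeaf _ [::]).
case: child vNc => [l a b r ->|l a ->|a aNs] vNc.
- exact: (@ChildLeaf _ (c :: l)).
- exact: (@ChildCenter _ (c :: l)).
constructor; rewrite inE negb_or aNs andbT.
by apply: contra_not_neq vNc => ->.
Qed.

Lemma path_tree_top s a t : uniq (rcons s a ++ t) ->
  path_tree (rcons s a ++ t) (path_top t) = Some (leaf a).
Proof.
rewrite ffunE path_parent_cat cat_uniq => /and3P[_ /hasPn tNs _].
rewrite ifN; first by rewrite path_parent_top map_rcons last_rcons.
case: t tNs => [|b t] tNs; first by rewrite mem_map_center.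
by rewrite mem_map_leaf tNs ?mem_head.
Qed.

Lemma center_below s t : uniq (s ++ t) ->
  center \in subtree (path_tree (s ++ t)) (path_top t).
Proof.
rewrite inE; elim: t s => [|a t IHt] s st_uniq; first exact: connect0.
rewrite -cat_rcons in st_uniq *; apply: connect_trans (IHt _ st_uniq) _.
by apply: connect1; rewrite /= path_tree_top.
Qed.

Lemma subtree_childless (T : parent_map (star n)) x :
  (forall y, T y != Some x) -> subtree T x = [set x].
Proof.
move=> Tx; apply/setP => y; rewrite !inE; apply/connectP/eqP => [[q]|->].
  case/lastP: q => [|q z] //; rewrite rcons_path last_rcons => /andP[_ Tz] eqz.
  by rewrite /= -eqz (negbTE (Tx _)) in Tz.
by exists [::].
Qed.

(** The subtree of b on the path contains the center, to which a is adjacent, so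
    it moves to a. *)
Lemma rotate_swap l a b r : uniq (l ++ [:: a, b & r]) ->
  rotate (path_tree (l ++ [:: a, b & r])) (leaf a) (leaf b) =
  path_tree (l ++ [:: b, a & r]).
Proof.
move=> s_uniq; move: (s_uniq); rewrite cat_uniq => /and3P[_ /hasPn Nl].
rewrite /= inE negb_or -andbA => /and4P[aNb aNr bNr _].
have aNl : a \notin l by apply: Nl; rewrite mem_head.
have bNl : b \notin l by apply: Nl; rewrite !inE eqxx orbT.
apply/ffunP => x; rewrite !ffunE !path_parent_cat !mem_map_leaf.
rewrite (negbTE aNl) /=.
have [->|xNb] := eqVneq x (leaf b).
  by rewrite mem_map_leaf (negbTE bNl) eqxx.
have [->|xNa] := eqVneq x (leaf a).
  by rewrite mem_map_leaf (negbTE aNl).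
case: (boolP (x \in map leaf l)) => [xl|_].
  by rewrite ifN //; apply: contra bNl => /andP[/eqP/path_parent_range[]].
have [->|xNr] := eqVneq x (path_top r).
  rewrite !path_parent_top eqxx ifT //; apply/existsP; exists center.
  rewrite andbT; have := center_below (s := l ++ [:: a; b]) (t := r).
  by rewrite -catA; apply.
rewrite (path_parent_notop _ (Some (leaf a)) xNr) ifN //.
by apply: contra bNr => /andP[/eqP/path_parent_range[[/eqP]|//]]; rewrite (negbTE aNb).
Qed.

(** The other children of the center are leaves without descendants, and no leaf
    is adjacent to a: they all stay with the center. *)
Lemma rotate_drop l a : uniq (rcons l a) ->
  rotate (path_tree (rcons l a)) (leaf a) center = path_tree l.
Proof.
rewrite rcons_uniq => /andP[aNl l_uniq].
apply/ffunP => x; rewrite !ffunE -cats1 !path_parent_cat !mem_map_leaf.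
rewrite (negbTE aNl) /= eqxx.
have [->|xNc] := eqVneq x center.
  by rewrite -[l in RHS]cats0 path_parent_cat mem_map_center.
have [->|xNa] := eqVneq x (leaf a).
  by rewrite path_parent_notin.
rewrite -[l in RHS]cats0 path_parent_cat ifN.
  by case: ifP => //= _; rewrite (negbTE xNc).
case: x xNc xNa => [c|] // _ cNa; rewrite mem_map_leaf.
apply/negP => /andP[/eqP Tc /existsP[y]].
have cNl : c \notin l.
  by apply/negP => cl; move: Tc; rewrite cl => /path_parent_center[|/negP].
have cNs : c \notin rcons l a.
  by rewrite mem_rcons inE negb_or cNl andbT; apply: contra_neq cNa => ->.
rewrite cats1 subtree_childless ?inE => [/andP[/eqP -> //]|z].
by apply: contra cNs; rewrite ffunE => /eqP/path_parent_range[].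
Qed.

Lemma rotate_add s a : a \notin s ->
  rotate (path_tree s) center (leaf a) = path_tree (rcons s a).
Proof.
move=> aNs; apply/ffunP => x; rewrite !ffunE -cats1 path_parent_cat.
have [->|xNa] := eqVneq x (leaf a).
  rewrite mem_map_leaf (negbTE aNs) /= eqxx -[s in LHS]cats0 path_parent_cat.
  by rewrite mem_map_center.
have [->|xNc] := eqVneq x center; first by rewrite mem_map_center.
rewrite ifN; last first.
  by apply: contra aNs => /andP[/eqP/path_parent_range[]].
rewrite -[s in LHS]cats0 path_parent_cat; case: ifP => //= _.
by rewrite (negbTE xNa) (negbTE xNc).
Qed.

Lemma rotate_path_tree s u v : uniq s -> path_tree s v = Some u ->
  exists a, rotate (path_tree s) u v = path_tree (flip a s).
Proof.
move=> s_uniq /path_tree_child[l a b r eqs|l a eqs|a aNs]; exists a.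
- rewrite eqs in s_uniq *; rewrite rotate_swap // flip_swap //.
  exact: uniq_mid_notin s_uniq.
- rewrite eqs in s_uniq *; rewrite rotate_drop // flip_last //.
  by move: s_uniq; rewrite rcons_uniq => /andP[].
by rewrite rotate_add // flip_notin.
Qed.

Lemma flip_rotate s a : uniq s ->
  exists u v, path_tree s v = Some u /\
    rotate (path_tree s) u v = path_tree (flip a s).
Proof.
case/(flipP a) => [l b r s_uniq aNl|l s_uniq aNl|{}s s_uniq aNs].
- exists (leaf a), (leaf b); rewrite rotate_swap //; split=> //.
  by rewrite -cat_rcons in s_uniq *; rewrite (path_tree_top s_uniq).
- exists (leaf a), center; rewrite rotate_drop //; split=> //.
  by rewrite -[rcons l a]cats0 in s_uniq *; rewrite (path_tree_top s_uniq).
exists center, (leaf a); rewrite rotate_add //; split=> //.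
by rewrite ffunE path_parent_notin.
Qed.

End StarTrees.

(** * Counting arrangements by their first entry *)

Section Arrangements.
Local Open Scope nat_scope.
Variable T : eqType.
Implicit Types (A s : seq T) (a b : T) (P : pred (seq T)).

(** For duplicate-free A, the duplicate-free sequences over A of size at most k,
    sorted by their first entry; every such sequence has size at most size A. *)
Fixpoint arrangements k A : seq (seq T) :=
  [::] :: if k is k'.+1 then
            flatten [seq [seq a :: s | s <- arrangements k' (rem a A)] | a <- A]
          else [::].

Lemma count_arrangements P k A : count P (arrangements k.+1 A) =
  P [::] + \sum_(a <- A) count (fun s => P (a :: s)) (arrangements k (rem a A)).
Proof.
rewrite /= count_flatten -map_comp sumnE big_map; congr (_ + _).
by apply: eq_bigr => a _; rewrite /= count_map.
Qed.

Lemma mem_arrangements k A s : uniq A -> size A <= k ->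
  (s \in arrangements k A) = uniq s && all (mem A) s.
Proof.
elim: k A s => [|k IHk] A s A_uniq A_le.
  move: A_le; rewrite leqn0 size_eq0 => /eqP ->.
  by case: s => [|a s]; rewrite /= inE //= andbF.
rewrite inE; case: s => [|a s] //=; apply/flatten_mapP/idP.
  case=> b bA /mapP[t t_in [-> ->]].
  move: t_in; rewrite IHk ?rem_uniq ?size_rem //; last by lia.
  case/andP=> t_uniq /allP tA; rewrite t_uniq bA /= andbT.
  apply/andP; split.
    by apply/negP => /tA /=; rewrite mem_rem_uniq // !inE eqxx.
  by apply/allP => x /tA /=; rewrite mem_rem_uniq // !inE => /andP[].
case/andP=> /andP[aNs s_uniq] /andP[aA /allP sA]; exists a => //.
apply: map_f; rewrite IHk ?rem_uniq ?size_rem //; last by lia.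
rewrite s_uniq /=; apply/allP => x xs /=; rewrite mem_rem_uniq // !inE.
have /= -> := sA x xs; rewrite andbT.
by apply: contraNneq aNs => <-.
Qed.

Lemma arrangements_uniq k A : uniq A -> uniq (arrangements k A).
Proof.
elim: k A => [|k IHk] A A_uniq //=; apply/andP; split.
  by apply/flatten_mapP => -[a _ /mapP[]].
apply: allpairs_uniq_dep => //= [a _|].
  by apply: IHk; apply: rem_uniq.
by move=> [a s] [b t] _ _ /= [-> ->].
Qed.

Fixpoint num_arrangements m : nat :=
  if m is m'.+1 then 1 + m * num_arrangements m' else 1.

Lemma size_arrangements k A :
  size A = k -> size (arrangements k A) = num_arrangements k.
Proof.
elim: k A => [|k IHk] A szA //.
rewrite -count_predT count_arrangements -[X in num_arrangements X]szA.
rewrite (eq_big_seq (fun=> num_arrangements k)) => [|a aA].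
  by rewrite big_const_seq count_predT iter_addn_0 szA mulnC.
by rewrite count_predT IHk // size_rem // szA.
Qed.

Opaque arrangements.

(** In both recurrences the first summand collects the sequences that begin with
    a. After a, every sequence avoiding a is allowed in [num_ordered]; in
    [num_crossing] the sequence either ends there or continues with b. Beginning
    with one of the m other elements leaves the same problem for the remaining
    m - 1, and sequences that are empty or begin with b do not count. *)
Fixpoint num_ordered m : nat :=
  num_arrangements m.+1 + if m is m'.+1 then m * num_ordered m' else 0.

Fixpoint num_crossing m : nat :=
  (num_arrangements m).+1 + if m is m'.+1 then m * num_crossing m' else 0.

Lemma count_cons2 P m a b A : a != b -> a \notin A -> b \notin A ->
  count P (arrangements m.+1 [:: a, b & A]) = P [::] +
    count (fun s => P (a :: s)) (arrangements m (b :: A)) +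
    count (fun s => P (b :: s)) (arrangements m (a :: A)) +
    \sum_(c <- A) count (fun s => P (c :: s)) (arrangements m [:: a, b & rem c A]).
Proof.
move=> aNb aNA bNA; rewrite count_arrangements !big_cons /= eqxx.
rewrite (negbTE aNb) eqxx !addnA; congr (_ + _).
apply: eq_big_seq => c cA.
have /negbTE -> : a != c by apply: contraNneq aNA => ->.
by have /negbTE -> : b != c by apply: contraNneq bNA => ->.
Qed.

Lemma count_ordered m a b A :
  size A = m -> a != b -> a \notin A -> b \notin A ->
  count (fun s => index a s < index b s) (arrangements m.+2 [:: a, b & A])
    = num_ordered m.
Proof.
move=> + aNb; elim: m A => [|m IHm] A szA aNA bNA.
all: rewrite count_cons2 //= (eq_count (a2 := predT));
  last by move=> s /=; rewrite eqxx (negbTE aNb).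
all: rewrite count_predT size_arrangements /= ?szA // (eq_count (a2 := pred0));
  last by move=> s /=; rewrite eqxx.
all: rewrite count_pred0 add0n addn0; congr (_ + _).
  by move/size0nil: szA => ->; rewrite big_nil.
rewrite (eq_big_seq (fun=> num_ordered m)) => [|c cA].
  by rewrite big_const_seq count_predT iter_addn_0 szA mulnC.
rewrite -(IHm (rem c A)) ?size_rem ?szA //.
- apply: eq_count => s /=.
  rewrite ifN; last by apply: contraNneq aNA => <-.
  by rewrite ifN //; apply: contraNneq bNA => <-.
- by apply: contra aNA; apply: mem_rem.
- by apply: contra bNA; apply: mem_rem.
Qed.

(** The condition holds for the empty sequence and for those that begin with b. *)
Lemma count_first m b A : size A = m -> uniq (b :: A) ->
  count (fun s => index b s == 0) (arrangements m.+1 (b :: A)) =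
    (num_arrangements m).+1.
Proof.
move=> szA /= /andP[bNA A_uniq].
rewrite count_arrangements big_cons /= eqxx.
rewrite (eq_count (a2 := predT)); last by move=> s /=; rewrite eqxx.
rewrite count_predT size_arrangements // big1_seq ?addn0 // => c /= cA.
rewrite (eq_count (a2 := pred0)) ?count_pred0 // => s /=.
by rewrite ifN //; apply: contraNneq bNA => <-.
Qed.

Lemma count_crossing m a b A : size A = m -> uniq [:: a, b & A] ->
  count (fun s => index b s == (index a s).+1) (arrangements m.+2 [:: a, b & A])
    = num_crossing m.
Proof.
elim: m A => [|m IHm] A szA abA_uniq.
all: move: (abA_uniq); rewrite /= inE negb_or -andbA => /and4P[aNb aNA bNA A_uniq].
all: rewrite count_cons2 //= (eq_count (a2 := fun s => index b s == 0));
  last by move=> s /=; rewrite eqxx (negbTE aNb) eqSS.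
all: rewrite count_first /= ?bNA ?szA // (eq_count (a2 := pred0));
  last by move=> s /=; rewrite eqxx.
all: rewrite count_pred0 add0n addn0; congr (_ + _).
  by move/size0nil: szA => ->; rewrite big_nil.
rewrite (eq_big_seq (fun=> num_crossing m)) => [|c cA].
  by rewrite big_const_seq count_predT iter_addn_0 szA mulnC.
rewrite -(IHm (rem c A)) ?size_rem ?szA //.
  apply: eq_count => s /=.
  rewrite ifN; last by apply: contraNneq bNA => <-.
  by rewrite ifN //; apply: contraNneq aNA => <-.
rewrite /= inE negb_or aNb rem_uniq // andbT /=.
apply/andP; split; first by apply: contra aNA; apply: mem_rem.
by apply: contra bNA; apply: mem_rem.
Qed.

(** Deleting a and b from a sequence counted by [num_crossing m] leaves one of
    some size j <= m, and there are j + 2 ways to undo this: ab at one of j + 1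
    places, or a alone at the end. The estimate is what the induction step of
    [num_crossing_lt] requires. *)
Lemma num_crossing_le m : num_crossing m <= m.+2 * num_arrangements m.
Proof. by elim: m => [|m IHm] //=; nia. Qed.

Lemma num_crossing_lt m : m.+1 * num_crossing m < 2 * num_ordered m.
Proof. by elim: m => [|m IHm] //=; have := num_crossing_le m; nia. Qed.

Lemma num_ordered_le m : 2 * num_ordered m <= num_arrangements m.+2.
Proof. by elim: m => [|m] //=; nia. Qed.

End Arrangements.

(** * A sparse cut of the rotation graph *)

Section StarRotationGraph.
Local Open Scope nat_scope.
Variable n : nat.
Local Notation G := (rotation_graph (star n)).
Implicit Types (T : G) (s : seq 'I_n) (a b c : 'I_n).

Lemma leaf_path_exists T :
  exists s, uniq s && (val T == path_tree s).
Proof.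
by have /path_treeP[s s_uniq ->] := valP T; exists s; rewrite s_uniq eqxx.
Qed.

Definition leaf_path T : seq 'I_n := xchoose (leaf_path_exists T).

Lemma leaf_path_uniq T : uniq (leaf_path T).
Proof. by have /andP[] := xchooseP (leaf_path_exists T). Qed.

Lemma leaf_pathK T : path_tree (leaf_path T) = val T.
Proof. by have /andP[_ /eqP] := xchooseP (leaf_path_exists T). Qed.

Lemma leaf_path_inj : injective leaf_path.
Proof. by move=> T T' eqs; apply: val_inj; rewrite -!leaf_pathK eqs. Qed.

Lemma leaf_path_surj s : uniq s -> exists T, leaf_path T = s.
Proof.
move=> s_uniq; have Ts : is_search_tree (path_tree s) by apply/path_treeP; exists s.
exists (Sub (path_tree s) Ts); apply: path_tree_inj; rewrite ?inE ?leaf_path_uniq //.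
by rewrite leaf_pathK.
Qed.

Lemma rotates_toP T T' : reflect
  (exists a, leaf_path T' = flip a (leaf_path T)) (rotates_to T T').
Proof.
have s_uniq := leaf_path_uniq T.
apply: (iffP existsP) => [[u /existsP[v]]|[a eqT']].
  rewrite -!leaf_pathK => /andP[/eqP Tv /eqP T'v].
  have [a eq_rot] := rotate_path_tree s_uniq Tv; exists a.
  apply: path_tree_inj; rewrite ?inE ?leaf_path_uniq ?flip_uniq //.
  by rewrite T'v.
have [u [v [Tv eq_rot]]] := flip_rotate a s_uniq.
exists u; apply/existsP; exists v; rewrite -!leaf_pathK Tv eqxx /=.
by rewrite eq_rot eqT'.
Qed.

(** A flip can be undone by a flip, so the two directions of a rotation need not be
    distinguished. *)
Lemma adj_flipP T T' : reflect
  (exists a, leaf_path T' = flip a (leaf_path T)) (adj T T').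
Proof.
apply: (iffP orP) => [[/rotates_toP //|/rotates_toP[a ->]]|/rotates_toP]; last by left.
have [b eqb] := flip_inverse a (leaf_path_uniq T').
by exists b.
Qed.

Lemma degree_rotation_star T : n <= degree T.
Proof.
have /fin_all_exists[f fE] a :
    exists T', leaf_path T' = flip a (leaf_path T).
  by apply: leaf_path_surj; rewrite flip_uniq ?leaf_path_uniq.
have f_inj : injective f.
  move=> a b /(congr1 leaf_path); rewrite !fE.
  exact: flip_inj (leaf_path_uniq T) _ _.
apply: (@leq_trans #|f @: 'I_n|); first by rewrite card_imset ?card_ord.
apply: subset_leq_card; apply/subsetP => _ /imsetP[a _ ->].
by rewrite inE; apply/adj_flipP; exists a.
Qed.

Lemma card_leaf_path (P : pred (seq 'I_n)) :
  #|[set T : G | P (leaf_path T)]| = count P (arrangements n (enum 'I_n)).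
Proof.
rewrite -size_filter cardE -(size_map leaf_path); apply/perm_size/uniq_perm.
- by rewrite map_inj_uniq ?enum_uniq //; apply: leaf_path_inj.
- by rewrite filter_uniq // arrangements_uniq // enum_uniq.
move=> s; rewrite mem_filter mem_arrangements ?enum_uniq ?size_enum_ord //.
apply/mapP/idP => [[T]|/and3P[Ps s_uniq _]].
  rewrite mem_enum inE => PT ->; rewrite PT leaf_path_uniq /=.
  by apply/allP => x _; rewrite /= mem_enum.
by have [T eqT] := leaf_path_surj s_uniq; exists T; rewrite ?mem_enum ?inE eqT.
Qed.

(** By [flip_crossing] a member of S has at most one neighbour outside S. *)
Lemma edge_boundary_precedes a b : a != b ->
  #|edge_boundary [set T : G | precedes a b (leaf_path T)]| <=
  #|[set T : G | index b (leaf_path T) == (index a (leaf_path T)).+1]|.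
Proof.
move=> aNb; rewrite card_edge_boundary -(card_in_imset (f := fst)).
  apply: subset_leq_card; apply/subsetP => _ /imsetP[[T T'] + ->].
  rewrite !inE /= => /and3P[PT PT' /adj_flipP[c eqT']]; rewrite eqT' in PT'.
  by have [_ ->] := flip_crossing (leaf_path_uniq T) aNb PT PT'.
move=> [T T1] [T3 T2] hin1 hin2 /= eqT; subst T3; move: hin1 hin2; rewrite !inE /=.
move=> /and3P[PT PT1 /adj_flipP[c1 eqT1]] /and3P[_ PT2 /adj_flipP[c2 eqT2]].
congr (_, _); apply: leaf_path_inj; rewrite eqT1 eqT2.
rewrite eqT1 in PT1; rewrite eqT2 in PT2.
have [-> _] := flip_crossing (leaf_path_uniq T) aNb PT PT1.
by have [-> _] := flip_crossing (leaf_path_uniq T) aNb PT PT2.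
Qed.

Lemma sparse_cut : 2 <= n -> exists2 S : {set G}, small_set S &
  n.-1 * #|edge_boundary S| < 2 * #|S|.
Proof.
move=> n_ge2.
have szn := size_enum_ord n; have enum_uniq_n := enum_uniq 'I_n.
have cardP := card_leaf_path.
case: (enum 'I_n) szn enum_uniq_n cardP => [|a [|b A]] /=; try by lia.
move=> szn; rewrite inE negb_or -andbA => /and4P[aNb aNA bNA A_uniq] cardP.
have szA : size A = n.-2 := congr1 (fun k => k.-2) szn.
have eqn : n = n.-2.+2 by rewrite -szA.
have ab_uniq : uniq [:: a, b & A] by rewrite /= inE negb_or aNb aNA bNA.
have card_S : #|[set T : G | precedes a b (leaf_path T)]| = num_ordered n.-2.
  by rewrite cardP [X in arrangements X]eqn; apply: count_ordered.
have card_B : #|[set T : G | index b (leaf_path T) == (index a (leaf_path T)).+1]|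
    = num_crossing n.-2.
  rewrite (cardP (fun s => index b s == (index a s).+1)).
  by rewrite [X in arrangements X]eqn; apply: count_crossing.
have card_G : #|G| = num_arrangements n.-2.+2.
  rewrite -cardsT -eqn -(size_arrangements (A := [:: a, b & A]) szn).
  rewrite -count_predT -cardP.
  by apply: eq_card => T; rewrite !inE.
have sparse := num_crossing_lt n.-2.
exists [set T : G | precedes a b (leaf_path T)].
  rewrite /small_set /= -card_gt0 card_S card_G -mul2n num_ordered_le andbT.
  by move: sparse; case: num_ordered => //; rewrite muln0.
have := edge_boundary_precedes aNb; rewrite card_S card_B => le_B.
apply: leq_ltn_trans sparse; rewrite leq_mul //.
by rewrite -ltnS -[X in _ <= X]eqn prednK // ltnW.
Qed.

End StarRotationGraph.

Theorem corollary2 (R : rcfType) (n : nat) (hn : (2 <= n)%N) :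
  edge_expansion R (rotation_graph (star n)) < 2 / (n%:R - 1) /\
  n%:R - 4 / (n%:R - 1) < lambda2 R (rotation_graph (star n)).
Proof.
have [S S_small S_sparse] := sparse_cut hn.
have n1_gt0 : 0 < n%:R - 1 :> R by rewrite subr_gt0 ltr1n.
have ratio_lt : expansion_ratio R S < 2 / (n%:R - 1).
  have S_gt0 : 0 < #|S|%:R :> R.
    by case/andP: S_small => S0 _; rewrite ltr0n card_gt0.
  rewrite /expansion_ratio ltr_pdivrMr // mulrAC ltr_pdivlMr //.
  have -> : n%:R - 1 = n.-1%:R :> R by rewrite -subn1 natrB // ltnW.
  by rewrite -!natrM ltr_nat mulnC.
split; first exact: le_lt_trans (edge_expansion_le R S_small) ratio_lt.
apply: (easy_cheeger (d := n) (S := S)) => //.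
  exact: degree_rotation_star.
by rewrite ltrD2l ltrN2 -[4%:R]/((2 * 2)%:R) natrM -mulrA ltr_pM2l.
Qed.
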